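(* Every formula is concise in the class of acylindrically hyperbolic groups. That is, for every first-order formula $\varphi(x)$ in the language of groups with one free variable and without parameters, and every acylindrically hyperbolic group $G$, if the set $G_\varphi=\{g\in G\mid \varphi(g)\text{ is true in }G\}$ is finite, then the subgroup $\varphi(G)=\langle G_\varphi\rangle$ of $G$ is finite.
   Context: A formula is a first-order formula $\varphi(x)$ in the language of groups $\{1,\cdot,{}^{-1}\}$ with one free variable $x$ and without parameters (no constants from $G$). For a group $G$, $G_\varphi:=\{g\in G\mid\varphi(g)\text{ is true in }G\}$ and $\varphi(G):=\langle G_\varphi\rangle$. A formula $\varphi$ is concise in a class $\mathcal C$ of groups if for every $G\in\mathcal C$, finiteness of $G_\varphi$ implies finiteness of $\varphi(G)$. An action $\circ$ of a group $G$ by isometries on a metric space $(\mathcal S,d)$ is acylindrical if for every $\varepsilon>0$ there exist $R\ge 0$ and $N\ge 0$ such that for every two points $x,y\in\mathcal S$ with $d(x,y)\ge R$ there are at most $N$ elements $g\in G$ satisfying $d(x,g\circ x)\le\varepsilon$ and $d(y,g\circ y)\le\varepsilon$. A group $G$ is acylindrically hyperbolic if it admits a non-elementary acylindrical action on a (Gromov) hyperbolic space; here non-elementary is equivalent to $G$ not being virtually cyclic and the action having unbounded orbits. *)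

(* Defs.v *)
From mathcomp Require Import all_boot all_order all_algebra.
From mathcomp Require Import all_classical all_reals.
From mathcomp Require Import topology.
Set Implicit Arguments.
Unset Strict Implicit.
Unset Printing Implicit Defensive.
Import Order.TTheory GRing.Theory Num.Theory.
Local Open Scope classical_set_scope.
Local Open Scope card_scope.
Local Open Scope ring_scope.

(* Well-scoped de Bruijn syntax: in [formula n] exactly the variables of 'I_n
   may occur free, and a quantifier binds variable [ord0] of its body, the
   older variables being shifted by one ([lift ord0]). *)
Inductive term (n : nat) : Type :=
| TVar of 'I_n
| TOne
| TMul of term n & term n
| TInv of term n.

Inductive formula : nat -> Type :=
| FEq n of term n & term n : formula n
| FFalse n : formula n
| FAnd n of formula n & formula n : formula n
| FOr n of formula n & formula n : formula n
| FImp n of formula n & formula n : formula n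
| FAll n of formula n.+1 : formula n
| FEx n of formula n.+1 : formula n.

Arguments FFalse {n}.

Definition env_cons (T : Type) (n : nat) (x : T) (e : 'I_n -> T) :
    'I_n.+1 -> T :=
  fun i => if unlift ord0 i is Some j then e j else x.

Fixpoint eval (G : groupType) (n : nat) (e : 'I_n -> G) (t : term n) : G :=
  match t with
  | TVar i => e i
  | TOne => 1%g
  | TMul t u => (eval e t * eval e u)%g
  | TInv t => (eval e t)^-1%g
  end.

Fixpoint holds (G : groupType) (n : nat) (f : formula n) :
    ('I_n -> G) -> Prop :=
  match f in formula m return ('I_m -> G) -> Prop with
  | FEq _ t u => fun e => eval e t = eval e u
  | FFalse _ => fun=> False
  | FAnd _ f h => fun e => holds f e /\ holds h e
  | FOr _ f h => fun e => holds f e \/ holds h e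
  | FImp _ f h => fun e => holds f e -> holds h e
  | FAll _ f => fun e => forall x : G, holds f (env_cons x e)
  | FEx _ f => fun e => exists x : G, holds f (env_cons x e)
  end.

Definition solutions (G : groupType) (phi : formula 1) : set G :=
  [set g | holds phi (fun=> g)].

Definition is_subgroup (G : groupType) (H : set G) : Prop :=
  [/\ H 1%g,
      forall x y, H x -> H y -> H (x * y)%g
    & forall x, H x -> H x^-1%g].

Definition generated (G : groupType) (A : set G) : set G :=
  smallest (@is_subgroup G) A.

Definition formula_subgroup (G : groupType) (phi : formula 1) : set G :=
  generated (solutions phi).

Definition concise_in (C : groupType -> Prop) (phi : formula 1) : Prop :=
  forall G : groupType, C G ->
    finite_set (@solutions G phi) -> finite_set (@formula_subgroup G phi).

Definition finite_index (G : groupType) (H : set G) : Prop :=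
  exists2 T : set G, finite_set T &
    forall g, exists2 t, T t & H (t^-1 * g)%g.

Definition virtually_cyclic (G : groupType) : Prop :=
  exists a : G, finite_index (generated [set a]).

Definition geodesic_segment (R : realType) (S : metricType R) (x y : S)
    (A : set S) : Prop :=
  exists gamma : R -> S,
    [/\ gamma 0 = x, gamma (mdist x y) = y,
        {in `[0, mdist x y] &,
           forall s t, mdist (gamma s) (gamma t) = `|s - t|}
      & A = [set gamma t | t in `[0, mdist x y]] ].

Definition geodesic_space (R : realType) (S : metricType R) : Prop :=
  forall x y : S, exists A, geodesic_segment x y A.

(* Rips' condition.  It is stated for the side [A] only: the other two sides
   are covered by relabelling the vertices cyclically. *)
Definition slim_triangles (R : realType) (S : metricType R) (delta : R) :
    Prop :=
  forall (x y z : S) (A B C : set S),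
    geodesic_segment x y A -> geodesic_segment y z B ->
    geodesic_segment z x C ->
    forall a, A a -> exists2 b, (B `|` C) b & mdist a b <= delta.

(* Hyperbolic spaces are geodesic: with the four-point condition alone, every
   finitely generated infinite group that is not virtually cyclic would act as
   required below, by translations on itself with the metric log (1 + d), d a
   word metric. *)
Definition hyperbolic_space (R : realType) (S : metricType R) : Prop :=
  geodesic_space S /\ exists2 delta : R, 0 <= delta & slim_triangles S delta.

Definition isometric_action (R : realType) (G : groupType) (S : metricType R)
    (act : G -> S -> S) : Prop :=
  [/\ forall x, act 1%g x = x,
      forall g h x, act (g * h)%g x = act g (act h x)
    & forall g x y, mdist (act g x) (act g y) = mdist x y].

Definition acylindrical (R : realType) (G : groupType) (S : metricType R)
    (act : G -> S -> S) : Prop :=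
  forall eps : R, 0 < eps ->
    exists (r : R) (N : nat), 0 <= r /\
      forall x y : S, r <= mdist x y ->
        [set g | mdist x (act g x) <= eps /\ mdist y (act g y) <= eps]
          #<= `I_N.

(* For an isometric action one orbit is unbounded iff all of them are; the
   existential form also excludes the empty space. *)
Definition unbounded_orbits (R : realType) (G : groupType) (S : metricType R)
    (act : G -> S -> S) : Prop :=
  exists x : S, forall c : R, exists g : G, c < mdist x (act g x).

Definition non_elementary (R : realType) (G : groupType) (S : metricType R)
    (act : G -> S -> S) : Prop :=
  ~ virtually_cyclic G /\ unbounded_orbits act.

Definition acylindrically_hyperbolic (R : realType) (G : groupType) : Prop :=
  exists (S : metricType R) (act : G -> S -> S),
    [/\ hyperbolic_space S, isometric_action act, acylindrical act
      & non_elementary act].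

(* Main.v *)
(** The solution set [A] of a formula is invariant under conjugation. If it is
    finite and all its elements have finite order, it generates a finite
    subgroup by Dietzmann's lemma. Otherwise some [a] in [A] has infinite order
    and its centralizer [C] has finite index; acylindricity along the unbounded
    orbit of [C] makes [d (x, a^n x)] unbounded. An element of [C] displaces [x]
    and [a^n x] by the same amount, so for [n] large it acts on the middle of a
    geodesic [[x, a^n x]] as a translation, up to a multiple of [delta].
    By acylindricity at two points of that middle part, some power [b] of [a]
    translates by more than [40 delta]; multiplying by powers of [b] brings the
    translation length of any given element of [C] below a bound depending only
    on [b]. Acylindricity then bounds the number of cosets of [<a>] in [C], so
    that [G] is virtually cyclic, which is excluded. *)

From mathcomp Require Import all_boot all_order all_algebra.
From mathcomp Require Import all_classical all_reals.
From mathcomp Require Import topology lra zify.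
Require Import Defs.
Set Implicit Arguments.
Unset Strict Implicit.
Unset Printing Implicit Defensive.
Import Order.TTheory GRing.Theory Num.Theory.
Local Open Scope classical_set_scope.
Local Open Scope card_scope.
Local Open Scope ring_scope.

(** * Invariance of definable sets under conjugation *)

Lemma eval_conjg (G : groupType) (n : nat) (e : 'I_n -> G) (g : G)
    (t : term n) :
  eval (fun i => (e i ^ g)%g) t = (eval e t ^ g)%g.
Proof.
elim: t => [i||t IHt u IHu|t IHt] //=; first by rewrite conj1g.
- by rewrite IHt IHu conjMg.
- by rewrite IHt conjVg.
Qed.

Lemma env_cons_conjg (G : groupType) (n : nat) (e : 'I_n -> G) (g x : G) :
  env_cons (x ^ g)%g (fun i => (e i ^ g)%g) =
    fun i => (env_cons x e i ^ g)%g.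
Proof. by apply/funext => i; rewrite /env_cons; case: (unlift _ _). Qed.

(** Conjugation by [g] is an automorphism; it is onto, so the quantifiers may range over the
    elements [x ^ g]. *)
Lemma holds_conjg (G : groupType) (n : nat) (f : formula n) (e : 'I_n -> G)
    (g : G) :
  holds f (fun i => (e i ^ g)%g) <-> holds f e.
Proof.
elim: f e => {n} [n t u|n|n f IHf h IHh|n f IHf h IHh|n f IHf h IHh|n f IHf
  |n f IHf] e /=.
- by rewrite !eval_conjg; split=> [/conjg_inj|->].
- by [].
- by rewrite IHf IHh.
- by rewrite IHf IHh.
- by rewrite IHf IHh.
- split=> H x.
    by apply/IHf; rewrite -env_cons_conjg; apply: H.
  by rewrite -(conjgKV g x) env_cons_conjg; apply/IHf.
- split=> -[x H]; last by exists (x ^ g)%g; rewrite env_cons_conjg; apply/IHf.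
  exists (x ^ g^-1)%g; apply/IHf.
  by rewrite -env_cons_conjg conjgKV.
Qed.

Lemma solutions_conjg (G : groupType) (phi : formula 1) (a g : G) :
  solutions phi a -> solutions phi (a ^ g)%g.
Proof. by move=> H; apply/(holds_conjg phi (fun=> a) g). Qed.

(** * Generated subgroups *)

Lemma generated_subgroup (G : groupType) (A : set G) :
  is_subgroup (generated A).
Proof.
split=> [H [[]] //|x y Ax Ay H HA|x Ax H HA].
  by have [[_ + _] _] := HA; apply; [apply: Ax|apply: Ay].
by have [[_ _ +] _] := HA; apply; apply: Ax.
Qed.

Lemma sub_generated (G : groupType) (A : set G) : A `<=` generated A.
Proof. exact: sub_gen_smallest. Qed.

Lemma subgroup_expg (G : groupType) (H : set G) (x : G) (n : nat) :
  is_subgroup H -> H x -> H (x ^+ n)%g.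
Proof.
by case=> H1 HM _ Hx; elim: n => [|n IHn]; rewrite ?expg0 // expgS; apply: HM.
Qed.

Lemma generated_commute (G : groupType) (a c h : G) :
  commute a c -> generated [set a] h -> commute h c.
Proof.
move=> ac ah; apply: (ah [set x | commute x c]); split; last by move=> _ ->.
split=> [|x y xc yc|x xc].
- exact/commute_sym/commute1.
- by apply/commute_sym/commuteM; apply/commute_sym.
- exact/commute_sym/commuteV/commute_sym.
Qed.

(** * Words and Dietzmann's lemma *)

Fixpoint word_prod (G : groupType) (w : seq G) : G :=
  if w is a :: v then (a * word_prod v)%g else 1%g.

Lemma word_prod_cat (G : groupType) (v w : seq G) :
  word_prod (v ++ w) = (word_prod v * word_prod w)%g.
Proof. by elim: v => [|x v IHv] /=; rewrite ?mul1g // IHv mulgA. Qed.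

Lemma word_prod_nseq (G : groupType) (a : G) (n : nat) :
  word_prod (nseq n a) = (a ^+ n)%g.
Proof. by elim: n => //= n ->; rewrite expgS. Qed.

Section Dietzmann.
Variables (G : groupType) (s : seq G).
Hypothesis sJ : forall a g : G, a \in s -> (a ^ g)%g \in s.

(** Moving [a ^+ k] left past a letter [b] turns [b] into [b ^ (a ^+ k)], which is again in [s]. *)
Lemma collect_letter (a : G) (w : seq G) (k : nat) :
  {subset w <= s} -> (k <= count_mem a w)%N ->
  exists w' : seq G, [/\ {subset w' <= s}, (size w' + k = size w)%N
               & word_prod w = (a ^+ k * word_prod w')%g].
Proof.
elim: w k => [|b w IHw] k ws /=.
  by rewrite leqn0 => /eqP ->; exists [::]; rewrite /= mulg1.
have bs : b \in s by apply: ws; rewrite mem_head.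
have {}ws : {subset w <= s} by move=> c cw; apply: ws; rewrite inE cw orbT.
case: eqVneq bs => [->|_] bs /=; last first.
  rewrite add0n => /(IHw _ ws) [w' [w's w'k ->]].
  exists ((b ^ (a ^+ k))%g :: w'); split=> /=.
  - by move=> c; rewrite inE => /orP[/eqP ->|/w's //]; apply: sJ.
  - by rewrite -w'k.
  - by rewrite [LHS]mulgA (conjgC b) -mulgA.
case: k => [|k]; rewrite add1n.
  move=> _; exists (a :: w); split=> /=; last by rewrite expg0 mul1g.
    by move=> c; rewrite inE => /orP[/eqP -> //|/ws].
  by rewrite addn0.
rewrite ltnS => /(IHw _ ws) [w' [w's w'k ->]]; exists w'; split=> //.
  by rewrite addnS w'k.
by rewrite expgS mulgA.
Qed.

Lemma size_count_sum (w : seq G) :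
  {subset w <= s} -> (size w <= \sum_(a <- s) count_mem a w)%N.
Proof.
elim: w => [//|b w IHw] ws /=.
rewrite big_split /= -add1n leq_add //; last first.
  by apply: IHw => c cw; apply: ws; rewrite inE cw orbT.
have bs : b \in s by apply: ws; rewrite mem_head.
by rewrite (big_rem b bs) /= eqxx leq_addr.
Qed.

(** Pigeonhole: a word longer than [size s * m] contains some letter [m] times; once collected,
    these copies cancel. *)
Lemma shorten_word (m : nat) (w : seq G) :
  (0 < m)%N -> (forall a, a \in s -> (a ^+ m = 1)%g) -> {subset w <= s} ->
  exists w' : seq G, [/\ {subset w' <= s}, (size w' <= size s * m)%N
               & word_prod w = word_prod w'].
Proof.
move=> m0 sm; have [n] := ubnP (size w); elim: n w => // n IHn w.
rewrite ltnS => wn ws.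
have [wB|wB] := leqP (size w) (size s * m); first by exists w.
have /hasP[a as_ am] : has (fun a => m <= count_mem a w)%N s.
  apply: contraLR wB => /hasPn wm; rewrite -leqNgt.
  apply: leq_trans (size_count_sum ws) _.
  apply: (@leq_trans (\sum_(a <- s) m)%N); last first.
    by rewrite big_const_seq count_predT iter_addn_0 mulnC.
  rewrite big_seq_cond [leqRHS]big_seq_cond leq_sum // => a.
  by rewrite andbT => /wm; rewrite -ltnNge => /ltnW.
have [v [vs vm ->]] := collect_letter ws am.
have [|//|w' [w's w'B ->]] := IHn v; first by apply: leq_trans wn; lia.
by exists w'; rewrite sm // mul1g.
Qed.

Lemma finite_words (B : nat) :
  finite_set [set word_prod w | w in
    [set w | {subset w <= s} /\ (size w <= B)%N]].
Proof.
elim: B => [|B IHB].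
  apply: sub_finite_set (finite_set1 1%g) => _ [[|b w] [_ wB] <-] //.
have fin2 := finite_image2 *%g (finite_seq s) IHB.
apply: (@sub_finite_set _ _ ([set 1%g] `|` _)); last first.
  by rewrite finite_setU; split; [exact: finite_set1|exact: fin2].
move=> _ [[|b w] [ws wB] <-]; [by left|right].
exists b; first by apply: ws; rewrite mem_head.
exists (word_prod w) => //; exists w => //; split=> // c cw.
by apply: ws; rewrite inE cw orbT.
Qed.

(* Dietzmann's lemma: a letter occurring [m] times can be collected at the
   front at the price of conjugating the other letters, and then cancels. *)
Lemma dietzmann (m : nat) :
  (0 < m)%N -> (forall a, a \in s -> (a ^+ m = 1)%g) ->
  finite_set (generated [set` s]).
Proof.
move=> m0 sm; apply: sub_finite_set (finite_words (size s * m)).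
have gen w : {subset w <= s} ->
    ([set word_prod w | w in
    [set w | {subset w <= s} /\ (size w <= size s * m)%N]]) (word_prod w).
  by move=> /(shorten_word m0 sm) [w' [w's w'B ->]]; exists w'.
apply: smallest_sub => [|a /= as_]; last first.
  have := gen [:: a]; rewrite /= mulg1; apply.
  by move=> b; rewrite inE => /eqP ->.
split=> [|_ _ [v [vs _] <-] [w [ws _] <-]|_ [w [ws _] <-]].
- exact: (gen [::]).
- rewrite -word_prod_cat; apply: gen => b; rewrite mem_cat.
  by case/orP; [apply: vs|apply: ws].
(* Words have no inverse letters, but the inverse of a letter [b] is [b ^+ m.-1]. *)
- suff [w' w's ->] : exists2 w', {subset w' <= s} &
      ((word_prod w)^-1 = word_prod w')%g by apply: gen.
  elim: w ws => [|b w IHw] ws /=; first by exists [::] => //=; rewrite invg1.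
  have bs : b \in s by apply: ws; rewrite mem_head.
  have [c cw|v vs vs'] := IHw; first by apply: ws; rewrite inE cw orbT.
  exists (v ++ nseq m.-1 b).
    by move=> c; rewrite mem_cat => /orP[/vs //|/nseqP[->]].
  rewrite word_prod_cat word_prod_nseq invgM vs'; congr (_ * _)%g.
  by apply: mulg1_eq; rewrite -expgS prednK // sm.
Qed.
End Dietzmann.

(** * Geodesics in hyperbolic spaces *)

Definition geodesic_path (R : realType) (S : metricType R) (gamma : R -> S)
    (L : R) : Prop :=
  {in `[0, L] &, forall s t, mdist (gamma s) (gamma t) = `|s - t|}.

Section Geodesics.
Variables (R : realType) (S : metricType R).
Implicit Types (gamma : R -> S) (x y z : S).

Lemma geodesic_dist gamma (L s t : R) :
  geodesic_path gamma L -> 0 <= s -> s <= t -> t <= L ->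
  mdist (gamma s) (gamma t) = t - s.
Proof.
move=> geo s0 st tL; rewrite geo ?in_itv /= ?s0 ?tL ?andbT.
- by rewrite distrC ger0_norm // subr_ge0.
- exact: le_trans tL.
- exact: le_trans st.
Qed.

Lemma geodesic_dist_le gamma (L s t k : R) :
  geodesic_path gamma L -> 0 <= s <= L -> 0 <= t <= L ->
  (mdist (gamma s) (gamma t) <= k) = (s - t <= k) && (t - s <= k).
Proof.
by move=> geo ? ?; rewrite geo ?in_itv //= ler_norml lerNl opprB andbC.
Qed.

Lemma geodesic_path_segment gamma (L : R) :
  0 <= L -> geodesic_path gamma L ->
  geodesic_segment (gamma 0) (gamma L) [set gamma t | t in `[0, L]].
Proof.
by move=> L0 geo; exists gamma; rewrite (geodesic_dist geo) // subr0.
Qed.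

Lemma segment_dist_le x y (A : set S) :
  geodesic_segment x y A -> forall a, A a ->
  mdist x a <= mdist x y /\ mdist a y <= mdist x y.
Proof.
move=> [gamma [g0 gL geo ->]] a [t tL <-].
move: tL; rewrite /= in_itv /= => /andP[t0 tL].
have L0 := mdist_ge0 x y.
split.
  by rewrite -{1}g0 (geodesic_dist geo) //; lra.
by rewrite -{1}gL (geodesic_dist geo) //; lra.
Qed.

Lemma isometry_path (f : S -> S) gamma (L : R) :
  (forall x y, mdist (f x) (f y) = mdist x y) ->
  geodesic_path gamma L -> geodesic_path (f \o gamma) L.
Proof. by move=> fiso geo s t sL tL /=; rewrite fiso geo. Qed.

Variable delta : R.
Hypothesis geoS : geodesic_space S.
Hypothesis slim : slim_triangles S delta.

(* Two slim triangles glued along a diagonal: the middle of one side of a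
   quadrilateral with two short sides follows the opposite side. *)
Lemma quadrilateral_near gamma gamma' (L L' D t : R) :
  0 <= delta -> 0 <= L -> geodesic_path gamma L -> geodesic_path gamma' L' ->
  mdist (gamma 0) (gamma' 0) <= D -> mdist (gamma L) (gamma' L') <= D ->
  D + 2 * delta < t -> t < L' - (D + 2 * delta) ->
  exists2 t', 0 <= t' <= L & mdist (gamma' t) (gamma t') <= 2 * delta.
Proof.
move=> delta0 L0 geo geo' D0 DL tD tL.
have Dge0 : 0 <= D by apply: le_trans (mdist_ge0 _ _) D0.
have [B segB] := geoS (gamma' L') (gamma 0).
have [C segC] := geoS (gamma 0) (gamma' 0).
have [E segE] := geoS (gamma L) (gamma' L').
have L'0 : 0 <= L' by lra.
have [|b [Bb|Cb] pb] :=
    slim (geodesic_path_segment L'0 geo') segB segC (a := gamma' t).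
- by exists t => //=; rewrite in_itv /=; apply/andP; split; lra.
- have [c [[t' + <-]|Ec] bc] :=
      slim segB (geodesic_path_segment L0 geo) segE Bb.
    rewrite /= in_itv /= => t'L; exists t' => //.
    by have := metric_triangle (gamma' t) b (gamma t'); lra.
  (* A point of a short side is within [D] of a vertex on [gamma'], which would put [gamma' t]
     within [D + 2 * delta] of that vertex. *)
  have [_ cL] := segment_dist_le segE Ec.
  have := metric_triangle (gamma' t) b c.
  have := metric_triangle (gamma' t) c (gamma' L').
  by rewrite (geodesic_dist geo') //; lra.
- have [_ bL] := segment_dist_le segC Cb.
  have := metric_triangle (gamma' t) b (gamma' 0).
  by rewrite (metric_sym (gamma' t) (gamma' 0)) (geodesic_dist geo') //; lra.
Qed.

(* The middle of a geodesic whose ends are moved little slides along itself.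
   The amount of sliding is read off at the parameter [L - u]: parameters at
   distance more than [2 u] from it are mapped in the same order. *)
Lemma isometry_shift (f : S -> S) gamma (L D u : R) :
  (forall x y, mdist (f x) (f y) = mdist x y) -> geodesic_path gamma L ->
  0 < delta -> D + 10 * delta <= u -> 5 * u <= L ->
  mdist (gamma 0) (f (gamma 0)) <= D -> mdist (gamma L) (f (gamma L)) <= D ->
  exists2 s, - u <= s <= u & forall t, u <= t -> t <= L - 4 * u ->
    mdist (f (gamma t)) (gamma (t + s)) <= 6 * delta.
Proof.
move=> fiso geo delta0 Du uL D0 DL.
have Dge0 : 0 <= D by apply: le_trans (mdist_ge0 _ _) D0.
have near t : u <= t -> t <= L - u -> exists t', [/\ 0 <= t' <= L,
    mdist (f (gamma t)) (gamma t') <= 2 * delta & - u <= t' - t <= u].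
  move=> ut tL.
  have [|||t' t'L tt'] := quadrilateral_near (gamma := gamma)
      (gamma' := f \o gamma) (L := L) (L' := L) (D := D) (t := t)
      (ltW delta0) _ geo (isometry_path fiso geo) D0 DL; [lra..|].
  exists t'; split=> //.
  have := metric_triangle (f (gamma 0)) (gamma t') (f (gamma t)).
  have := metric_triangle (f (gamma 0)) (gamma 0) (gamma t').
  have := metric_triangle (gamma 0) (f (gamma t)) (gamma t').
  have := metric_triangle (gamma 0) (f (gamma 0)) (f (gamma t)).
  rewrite fiso (metric_sym (gamma t')) (metric_sym (f (gamma 0)) (gamma 0)).
  move: tt' t'L => /= tt' /andP[t'0 t'L].
  by rewrite !(geodesic_dist geo) //; lra.
have [||t1 [t1L t1d t1s]] := near (L - u); [lra..|].
exists (t1 - (L - u)) => // t ut tL.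
have [||t' [t'L t'd t's]] := near t; [lra..|].
have tt1 : mdist (gamma t) (gamma (L - u)) = L - u - t.
  by rewrite (geodesic_dist geo) //; lra.
have t't1 : mdist (gamma t') (gamma t1) = t1 - t'.
  by rewrite (geodesic_dist geo) //; lra.
(* Here [t' <= t1]. Both images are within [2 * delta] of the geodesic, so [t1 - t'] and [L - u - t]
   differ by at most [4 * delta]; a further [2 * delta] gives [6 * delta]. *)
have h1 := metric_triangle (f (gamma t)) (gamma t') (gamma t1).
have h2 := metric_triangle (f (gamma t)) (gamma t1) (f (gamma (L - u))).
have h3 := metric_triangle (gamma t') (f (gamma (L - u))) (gamma t1).
have h4 := metric_triangle (gamma t') (f (gamma t)) (f (gamma (L - u))).
move: h1 h2 h3 h4; rewrite fiso tt1 t't1 (metric_sym (gamma t1) (f _)).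
rewrite (metric_sym (gamma t') (f (gamma t))) => h1 h2 h3 h4.
have := metric_triangle (f (gamma t)) (gamma t') (gamma (t + (t1 - (L - u)))).
have : mdist (gamma t') (gamma (t + (t1 - (L - u)))) <= 4 * delta.
  by rewrite (geodesic_dist_le _ geo) //; lra.
lra.
Qed.

End Geodesics.

(** * Counting, displacement and sliding along a geodesic *)

Lemma card_gt_sequence (T : Type) (A : set T) (F : nat -> T) (N : nat) :
  (forall i, (i <= N)%N -> A (F i)) ->
  (forall i j, (i < j <= N)%N -> F i <> F j) -> ~ (A #<= `I_N).
Proof.
move=> FA Finj AN.
have Fi : {in `I_N.+1 &, injective F}.
  move=> i j; rewrite !inE /= !ltnS => iN jN Fij.
  have [ij|ji|//] := ltngtP i j.
    by case: (Finj i j _ Fij); rewrite ij.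
  by case: (Finj j i); rewrite ?ji ?iN.
have : `I_N.+1 #<= `I_N.
  apply: card_le_trans AN; apply: card_le_trans (_ : F @` `I_N.+1 #<= A).
    by have := inj_card_eq Fi; rewrite card_eq_le => /andP[].
  by apply: subset_card_le => _ [i iN <-]; apply: FA.
by rewrite card_le_II ltnn.
Qed.

Section Action.
Variables (R : realType) (G : groupType) (S : metricType R).
Variable act : G -> S -> S.
Hypothesis actI : isometric_action act.

Let act1 p : act 1%g p = p. Proof. by case: actI. Qed.
Let actM g h p : act (g * h)%g p = act g (act h p). Proof. by case: actI. Qed.
Let act_dist g p q : mdist (act g p) (act g q) = mdist p q.
Proof. by case: actI. Qed.

Definition disp (p : S) (g : G) : R := mdist p (act g p).

Lemma disp_ge0 p g : 0 <= disp p g. Proof. exact: mdist_ge0. Qed.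

Lemma dispM p g h : disp p (g * h)%g <= disp p g + disp p h.
Proof.
apply: le_trans (metric_triangle _ (act g p) _) _.
by rewrite actM act_dist.
Qed.

Lemma dispV p g : disp p g^-1%g = disp p g.
Proof.
by rewrite /disp -(act_dist g) -actM mulgV act1 metric_sym.
Qed.

Lemma disp_commute p g h : commute g h -> disp (act h p) g = disp p g.
Proof. by move=> gh; rewrite /disp -actM gh actM act_dist. Qed.

Variables (gamma : R -> S) (L delta : R).
Hypothesis delta0 : 0 < delta.
Hypothesis geoS : geodesic_space S.
Hypothesis slim : slim_triangles S delta.
Hypothesis gammaP : geodesic_path gamma L.

Definition disp_ends (g : G) (D : R) : Prop :=
  disp (gamma 0) g <= D /\ disp (gamma L) g <= D.

(** [6 * delta] is the error in [isometry_shift]. The slide of a product is read off afresh from the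
    displacements of the ends, so this error does not accumulate. *)
Definition slides (g : G) (s u v : R) : Prop :=
  forall t, u <= t -> t <= v ->
    mdist (act g (gamma t)) (gamma (t + s)) <= 6 * delta.

Lemma disp_endsM g h D E :
  disp_ends g D -> disp_ends h E -> disp_ends (g * h)%g (D + E).
Proof.
move=> [g0 gL] [h0 hL]; split; apply: le_trans (dispM _ _ _) _; exact: lerD.
Qed.

Lemma disp_ends_slides g D u :
  D + 10 * delta <= u -> 5 * u <= L -> disp_ends g D ->
  exists2 s, - u <= s <= u & slides g s u (L - 4 * u).
Proof.
move=> Du uL [g0 gL].
by have := isometry_shift geoS slim (act_dist g) gammaP delta0 Du uL g0 gL.
Qed.

Lemma slidesV g s u v : slides g s u v -> slides g^-1%g (- s) (u + s) (v + s).
Proof.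
move=> gs t ut tv; rewrite -(act_dist g) -actM mulgV act1 metric_sym.
rewrite -{2}[t](subrK s); apply: gs; lra.
Qed.

Variables (K : set G) (b : G) (sb E : R).
Hypothesis KG : is_subgroup K.
Hypothesis Kb : K b.
Hypothesis bE : disp_ends b E.
Hypothesis sbE : - (E + 10 * delta) <= sb <= E + 10 * delta.
Hypothesis sb_big : 40 * delta < `|sb|.
Hypothesis b_slides : slides b sb (E + 10 * delta) (L - 4 * (E + 10 * delta)).

(** Whichever of [b] and [b^-1] slides forward is taken. Inverting moves the window by [sb], so up
    to [5 * (E + 10 * delta)] is lost at the far end; [9 * U <= L] leaves room up to [4 * U]. *)
Lemma slide_pos U :
  E + 10 * delta <= U -> 9 * U <= L ->
  exists h s, [/\ K h, disp_ends h E, 40 * delta < s <= E + 10 * delta,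
    slides h s (2 * U) (4 * U) & slides h^-1%g (- s) (2 * U) (4 * U)].
Proof.
move=> EU UL; have /andP[sb1 sb2] := sbE.
have b1 : slides b sb (2 * U) (4 * U).
  by move=> t ? ?; apply: b_slides; lra.
have b2 : slides b^-1%g (- sb) (2 * U) (4 * U).
  by move=> t ? ?; apply: (slidesV b_slides); lra.
have [sb0|sb0] := leP 0 sb.
  exists b, sb; split=> //.
  by move: sb_big; rewrite ger0_norm //; lra.
exists b^-1%g, (- sb); split=> //; last by rewrite invgK opprK.
- by case: KG => _ _; apply.
- by case: bE => b0 bL; split; rewrite dispV.
- by move: sb_big; rewrite ltr0_norm //; lra.
Qed.

(* As long as [g] slides by more than [b] can, one of [b] and [b^-1] brings it
   back by a definite amount, the errors being at most [18 * delta]. *)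
Lemma slide_reduce m U D g s :
  disp_ends g D -> D + m%:R * E + 10 * delta <= U -> E + 10 * delta <= U ->
  9 * U <= L -> - U <= s <= U ->
  - (E + 10 * delta + m%:R * delta) <= s <= E + 10 * delta + m%:R * delta ->
  slides g s U (L - 4 * U) ->
  exists h s', [/\ K h, - (E + 10 * delta) <= s' <= E + 10 * delta
    & slides (h * g)%g s' U (L - 4 * U)].
Proof.
have E0 : 0 <= E by case: bE => b0 _; apply: le_trans (disp_ge0 _ _) b0.
have d0 := delta0.
move=> gD DU EU UL.
elim: m g D s gD DU => [|m IHm] g D s gD DU sU sm gs.
  exists 1%g, s; rewrite mul1g; split=> //; first by case: KG.
  by move: sm; rewrite mul0r addr0.
have m0 : 0 <= m%:R :> R by [].
have mE : 0 <= m%:R * E by apply: mulr_ge0.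
have mdl : 0 <= m%:R * delta by apply: mulr_ge0 => //; apply: ltW.
rewrite -natr1 mulrDl mul1r in DU sm.
have [sE|sE] := boolP (- (E + 10 * delta) <= s <= E + 10 * delta).
  by exists 1%g, s; rewrite mul1g; split=> //; case: KG.
have [h [sh [Kh hE shE hs hVs]]] := slide_pos EU UL.
(* [k] will be [h] or its inverse. The new slide [s1] of [k * g] differs from [s + s'] by at most
   [18 * delta], so this bound on [s + s'] keeps [s1] within the range required for [m]. *)
suff [k [s' [Kk kE ks' s'U ss']]] : exists k s', [/\ K k, disp_ends k E,
    slides k s' (2 * U) (4 * U), - U <= s' <= U
  & - (E - 20 * delta + m%:R * delta) <= s + s'
      <= E - 20 * delta + m%:R * delta].
  have kgD := disp_endsM kE gD.
  have [||s1 s1U ks1] := disp_ends_slides (u := U) _ _ kgD; [lra..|].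
  have [| |h1 [s2 [Kh1 s2E h1s2]]] := IHm (k * g)%g (E + D) s1 kgD _ s1U _ ks1.
  - lra.
  (* The slides are compared at parameter [3 * U], which [g] carries into the window from [2 * U] to
     [4 * U] of [k]. Three errors of [6 * delta] add up to [18 * delta]. *)
  - have [t1 t2] : 0 <= 3 * U + s1 <= L /\ 0 <= 3 * U + (s + s') <= L.
      by split; lra.
    have d1 : mdist (act (k * g)%g (gamma (3 * U))) (gamma (3 * U + s1))
        <= 6 * delta by apply: ks1; lra.
    have d2 : mdist (act g (gamma (3 * U))) (gamma (3 * U + s)) <= 6 * delta.
      by apply: gs; lra.
    have d3 : mdist (act k (gamma (3 * U + s))) (gamma (3 * U + s + s'))
        <= 6 * delta by apply: ks'; lra.
    rewrite -addrA in d3.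
    have : mdist (gamma (3 * U + s1)) (gamma (3 * U + (s + s')))
        <= 18 * delta.
      have h1 := metric_triangle (gamma (3 * U + s1))
        (act (k * g)%g (gamma (3 * U))) (gamma (3 * U + (s + s'))).
      have h2 := metric_triangle (act (k * g)%g (gamma (3 * U)))
        (act k (gamma (3 * U + s))) (gamma (3 * U + (s + s'))).
      move: h1 h2; rewrite (metric_sym (gamma (3 * U + s1)) (act _ _)).
      rewrite [act (k * g)%g _]actM in d1 *; rewrite act_dist; lra.
    by rewrite (geodesic_dist_le _ gammaP) //; lra.
  - exists (h1 * k)%g, s2; split=> //; last by rewrite -mulgA.
    by case: KG => _ + _; apply.
have [s0|s0] := leP 0 s.
  have big : E + 10 * delta < s.
    by rewrite ltNge; apply: contra sE => sE; apply/andP; split; lra.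
  exists h^-1%g, (- sh); split=> //.
  - by case: KG => _ _; apply.
  - by case: hE => h0 hL; split; rewrite dispV.
  - by lra.
  - by lra.
have big : s < - (E + 10 * delta).
  by rewrite ltNge; apply: contra sE => sE; apply/andP; split; lra.
by exists h, sh; split=> //; lra.
Qed.

End Action.

(** * Finite index and coset representatives *)

Lemma finite_centralizer_index (G : groupType) (A : set G) (a : G) :
  finite_set A -> (forall g, A (a ^ g)%g) -> finite_index [set c | commute a c].
Proof.
move=> Afin Aa.
(* Orbit-stabilizer: left cosets of the centralizer correspond to conjugates of [a], and [t] picks a
   conjugating element for each. *)
have /choice[t tP] : forall a', exists t,
    (exists g, a' = (a ^ g^-1)%g) -> a' = (a ^ t^-1)%g.
  move=> a'; have [[g ->]|na] := pselect (exists g, a' = (a ^ g^-1)%g).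
    by exists g.
  by exists 1%g.
exists (t @` A); first exact: finite_image.
move=> g; exists (t (a ^ g^-1)%g); first by exists (a ^ g^-1)%g.
rewrite /=; have /(congr1 (fun b => (b ^ g)%g)) :=
  tP (a ^ g^-1)%g (ex_intro _ g erefl).
rewrite conjgKV -conjgM => /esym/conjg_fixP/commgP ac.
exact: ac.
Qed.

Lemma finite_index_trans (G : groupType) (C K : set G) (T : set G) :
  finite_index C -> finite_set T ->
  (forall c, C c -> exists2 t, T t & K (t^-1 * c)%g) -> finite_index K.
Proof.
move=> [T1 T1fin T1P] Tfin TP.
exists [set (t1 * t)%g | t1 in T1 & t in T]; first exact: finite_image2.
move=> g; have [t1 T1t1 /TP[t Tt Kt]] := T1P g.
exists (t1 * t)%g; first by exists t1 => //; exists t.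
by rewrite invgM -mulgA.
Qed.

(** Greedy choice: without a finite net, any finite list extends by one more element. Sequences of
    every finite length suffice against a uniform bound. *)
Lemma finite_net_or_sequence (T : Type) (C : set T) (e : T -> T -> Prop) :
  (exists2 F : set T, finite_set F & forall c, C c -> exists2 t, F t & e t c) \/
  (forall n, exists f : nat -> T, (forall i, (i < n)%N -> C (f i)) /\
     forall i j, (i < j < n)%N -> ~ e (f i) (f j)).
Proof.
have [H|nH] := pselect (exists2 F : set T, finite_set F &
  forall c, C c -> exists2 t, F t & e t c); [by left|right].
have ext F : finite_set F -> exists2 c, C c & forall t, F t -> ~ e t c.
  move=> Ffin; apply: contrapT => nc; apply: nH; exists F => // c Cc.
  apply: contrapT => nt; apply: nc; exists c => // t Ft et.
  by apply: nt; exists t.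
elim=> [|n [f [fC fe]]].
  have [c _ _] := ext set0 (finite_set0 _); exists (fun=> c).
  by split=> // i j; rewrite ltn0 andbF.
have [c Cc cP] := ext _ (finite_image f (finite_II n)).
exists (fun i => if (i < n)%N then f i else c); split=> [i _|i j].
  by case: ifP => // /fC.
move=> /andP[ij]; rewrite ltnS leq_eqVlt => /orP[/eqP jn|jn].
  by rewrite jn in ij *; rewrite ij ltnn; apply: cP; exists i.
by rewrite jn (ltn_trans ij jn); apply: fe; rewrite ij.
Qed.

(** * The centralizer of an element of infinite order *)

Section Centralizer.
Variables (R : realType) (G : groupType) (S : metricType R).
Variable act : G -> S -> S.
Hypothesis actI : isometric_action act.
Hypothesis acyl : acylindrical act.

Lemma finite_index_unbounded (C : set G) :
  unbounded_orbits act -> finite_index C ->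
  exists x, forall r, exists2 c, C c & r < disp act x c.
Proof.
move=> [x xP] [T Tfin TC]; exists x => r.
have [s Ts] : exists s : seq G, T = [set` s] by apply/finite_seqP.
(* The sum bounds the displacement by each [t] in [T], hence the loss in passing from [g] to
   [t^-1 * g]. *)
have [g gP] := xP (\sum_(t <- s) disp act x t + r).
have [t Tt Ct] := TC g; exists (t^-1 * g)%g => //.
have : disp act x t <= \sum_(t <- s) disp act x t.
  rewrite Ts /= in Tt; rewrite (big_rem t Tt) /= lerDl sumr_ge0 // => u _.
  exact: disp_ge0.
have := dispM actI x t (t^-1 * g)%g; rewrite mulVKg.
by move: gP; rewrite -/(disp act x g); lra.
Qed.

Variables (a : G) (x : S).
Hypothesis a_inf : forall i j : nat, (i < j)%N -> (a ^+ i <> a ^+ j)%g.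
Hypothesis Cx : forall r, exists2 c, commute a c & r < disp act x c.

Let C := [set c : G | commute a c].
Let K := generated [set a].

Let aX n : K (a ^+ n)%g.
Proof.
by apply: subgroup_expg (generated_subgroup _) _; apply: sub_generated.
Qed.

(** Otherwise the powers of [a] would move [act c x] as little as [x] for every [c] commuting with
    [a]; taking [act c x] far from [x] contradicts acylindricity. *)
Lemma disp_powers_unbounded r : exists n, r < disp act x (a ^+ n)%g.
Proof.
apply: contrapT => nr.
have {}nr n : disp act x (a ^+ n)%g <= r.
  by rewrite leNgt; apply/negP => rn; apply: nr; exists n.
have r1 : 0 < Num.max r 1 by rewrite lt_max ltr01 orbT.
have [r0 [N [_ AN]]] := acyl r1; have [c ac cr] := Cx r0.
apply: (card_gt_sequence (F := fun i => (a ^+ i)%g) _ _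
  (AN x (act c x) (ltW cr))).
  move=> i _ /=; rewrite -/(disp act x _) -/(disp act (act c x) _).
  rewrite disp_commute //; last first.
    by apply/commute_sym/commuteX/commute_sym.
  by rewrite !le_max nr.
by move=> i j /andP[ij _]; apply: a_inf.
Qed.

(** The bound is uniform because [N0], [E] and [N1] are fixed before [f]; what depends on [f] only
    decides how long a geodesic is needed. *)
Lemma centralizer_cosets_bounded (delta : R) :
  geodesic_space S -> 0 < delta -> slim_triangles S delta ->
  exists N, forall f : nat -> G, (forall i, (i < N)%N -> C (f i)) ->
    exists i j, (i < j < N)%N /\ K ((f i)^-1 * f j)%g.
Proof.
move=> geoS d0 slim.
(* A slide of at most [40 * delta] plus the error [6 * delta]. *)
have e0 : 0 < 46 * delta by lra.
have [r0 [N0 [r0_ge0 A0]]] := acyl e0.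
pose E := \sum_(0 <= i < N0.+1) disp act x (a ^+ i)%g.
have EP i : (i <= N0)%N -> disp act x (a ^+ i)%g <= E.
  move=> iN; rewrite /E (big_rem i) ?mem_index_iota //= lerDl.
  by apply: sumr_ge0 => u _; apply: disp_ge0.
have E0 : 0 <= E by apply: le_trans (EP 0 _); rewrite ?disp_ge0.
(* A reduced slide of at most [E + 10 * delta] plus the error [6 * delta]. *)
have e1 : 0 < E + 16 * delta by lra.
have [r1 [N1 [r1_ge0 A1]]] := acyl e1.
exists N1.+1 => f fC; apply: contrapT => nf.
pose D := \sum_(0 <= i < N1.+1) disp act x (f i).
have DP i : (i <= N1)%N -> disp act x (f i) <= D.
  move=> iN; rewrite /D (big_rem i) ?mem_index_iota //= lerDl.
  by apply: sumr_ge0 => u _; apply: disp_ge0.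
have D0 : 0 <= D by apply: le_trans (DP 0 _); rewrite ?disp_ge0.
pose m := Num.bound ((D + E) / delta).
have mP : D <= m%:R * delta.
  have : (D + E) / delta < m%:R
    by apply: archi_boundP; rewrite divr_ge0 ?addr_ge0 // ltW.
  by rewrite ltr_pdivrMr //; lra.
have mE : 0 <= m%:R * E by apply: mulr_ge0.
(* [m%:R * E] pays for up to [m] multiplications by [b] or its inverse. Below, [r0] and [r1] leave
   room for points that far apart in the sliding windows. *)
pose U := E + D + m%:R * E + 10 * delta.
have [n nL] := disp_powers_unbounded (9 * U + r0 + r1).
have [gamma [g0 gL gP' _]] : exists gamma : R -> S,
    [/\ gamma 0 = x, gamma (disp act x (a ^+ n)%g) = act (a ^+ n)%g x,
    geodesic_path gamma (disp act x (a ^+ n)%g) & True].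
  by have [A [gamma [? ? ? _]]] := geoS x (act (a ^+ n)%g x); exists gamma.
set L := disp act x (a ^+ n)%g in nL gL gP'.
have UE : E + 10 * delta <= U by rewrite /U; lra.
have UD : D + m%:R * E + 10 * delta <= U by rewrite /U; lra.
have ends g r : commute a g -> disp act x g <= r -> disp_ends act gamma L g r.
  move=> ag gr; split; first by rewrite g0.
  by rewrite gL disp_commute //; apply: commuteX; apply: commute_sym.
(* Otherwise the [N0 + 1] powers [a ^+ i] with [i <= N0] would all move two points at distance [r0]
   by at most [46 * delta]. *)
have [b [s [Kb bE sE s_big bs]]] : exists b s,
    [/\ K b, disp_ends act gamma L b E,
    - (E + 10 * delta) <= s <= E + 10 * delta, 40 * delta < `|s|
  & slides act gamma delta b s (E + 10 * delta) (L - 4 * (E + 10 * delta))].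
  apply: contrapT => nb.
  have r0P : r0 <= mdist (gamma (E + 10 * delta)) (gamma (E + 10 * delta + r0)).
    by rewrite (geodesic_dist gP'); lra.
  apply: (card_gt_sequence (F := fun i => (a ^+ i)%g) _ _ (A0 _ _ r0P)).
    move=> i iN0; have aE := ends _ _ (commuteX i (commute_refl a)) (EP i iN0).
    have [||s sE ss] := disp_ends_slides actI d0 geoS slim gP'
        (u := E + 10 * delta) _ _ aE; [lra..|].
    have [s1 s2] : - (40 * delta) <= s /\ s <= 40 * delta.
      apply/andP; rewrite -ler_norml leNgt; apply/negP => s40; apply: nb.
      by exists (a ^+ i)%g, s.
    have small t : E + 10 * delta <= t -> t <= E + 10 * delta + r0 ->
        mdist (gamma t) (act (a ^+ i)%g (gamma t)) <= 46 * delta.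
      move=> t1 t2.
      have : mdist (act (a ^+ i)%g (gamma t)) (gamma (t + s)) <= 6 * delta.
        by apply: ss; lra.
      have : mdist (gamma t) (gamma (t + s)) <= 40 * delta.
        by rewrite (geodesic_dist_le _ gP'); lra.
      have := metric_triangle (gamma t) (gamma (t + s))
        (act (a ^+ i)%g (gamma t)).
      by rewrite (metric_sym (gamma (t + s))); lra.
    by split; apply: small; lra.
  by move=> i j /andP[ij _]; apply: a_inf.
have red i : exists h, (i <= N1)%N -> K h /\ exists2 s',
    - (E + 10 * delta) <= s' <= E + 10 * delta
  & slides act gamma delta (h * f i)%g s' U (L - 4 * U).
  have [iN|iN] := leqP i N1; last by exists 1%g.
  have fD := ends _ _ (fC i iN) (DP i iN).
  have [||si siD fs] := disp_ends_slides actI d0 geoS slim gP'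
        (u := D + 10 * delta) _ _ fD; [lra..|].
  have siU : - U <= si <= U by lra.
  have {}fs : slides act gamma delta (f i) si U (L - 4 * U).
    by move=> t t1 t2; apply: fs; lra.
  have [||h [s' [Kh s'E hs]]] := slide_reduce (m := m) actI d0 geoS slim gP'
     (generated_subgroup [set a]) Kb bE sE s_big bs
     fD UD UE _ siU _ fs; [lra..|].
  by exists h => _; split=> //; exists s'.
have {red} /choice[h hP] := red.
have r1P : r1 <= mdist (gamma U) (gamma (U + r1)).
  by rewrite (geodesic_dist gP'); lra.
apply: (card_gt_sequence (F := fun i => (h i * f i)%g) _ _ (A1 _ _ r1P)).
  move=> i /hP[_ [s' s'E hs]].
  have small t : U <= t -> t <= U + r1 ->
      mdist (gamma t) (act (h i * f i)%g (gamma t)) <= E + 16 * delta.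
    move=> t1 t2.
    have : mdist (act (h i * f i)%g (gamma t)) (gamma (t + s')) <= 6 * delta.
      by apply: hs; lra.
    have : mdist (gamma t) (gamma (t + s')) <= E + 10 * delta.
      by rewrite (geodesic_dist_le _ gP'); lra.
    have := metric_triangle (gamma t) (gamma (t + s'))
      (act (h i * f i)%g (gamma t)).
    by rewrite (metric_sym (gamma (t + s'))); lra.
  by split; apply: small; lra.
move=> i j /andP[ij jN] hfij; apply: nf; exists i, j.
rewrite ltnS ij jN; split=> //.
have iN := leq_trans (ltnW ij) jN.
have [[Ki _] [Kj _]] := (hP i iN, hP j jN).
have [K1 KM KV] := generated_subgroup [set a].
(* This element commutes with [f i], so it equals [(f i)^-1 * f j]. *)
have Kk : K ((h j)^-1 * h i)%g by apply: KM => //; apply: KV.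
have <- : ((h j)^-1 * h i * f i = f j)%g by rewrite -mulgA hfij mulKg.
by rewrite (generated_commute (fC i iN) Kk) mulKg.
Qed.

End Centralizer.

(** * The torsion case and the infinite-order case *)

Lemma infinite_order_powers (G : groupType) (a : G) :
  (forall n, (0 < n)%N -> (a ^+ n <> 1)%g) ->
  forall i j : nat, (i < j)%N -> (a ^+ i <> a ^+ j)%g.
Proof.
move=> an i j ij; rewrite -(subnK (ltnW ij)) addnC expgnDr.
rewrite -[X in X <> _]mulg1 => /mulgI/esym.
by apply: an; rewrite subn_gt0.
Qed.

Theorem theorem1p1 (R : realType) (phi : formula 1) :
  concise_in (@acylindrically_hyperbolic R) phi.
Proof.
move=> G [S [act [[geoS [delta delta0 slim]] actI acyl [nvc unb]]]] Afin.
have [s sA] : exists s : seq G, solutions phi = [set` s] by apply/finite_seqP.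
have sJ (a g : G) : a \in s -> (a ^ g)%g \in s.
  have := @solutions_conjg G phi a g; rewrite sA; exact.
have [[a [as_ an]]|tors] := pselect (exists a, a \in s /\
    forall n, (0 < n)%N -> (a ^+ n <> 1)%g); last first.
  have /choice[o oP] : forall a, exists n, (0 < n)%N /\
      (a \in s -> (a ^+ n = 1)%g).
    move=> a; apply: contrapT => na; apply: tors; exists a; split.
      by apply: contrapT => as_; apply: na; exists 1%N; split.
    by move=> n n0 a1; apply: na; exists n; split.
  rewrite /formula_subgroup sA.
  (* The product of the chosen exponents is a common exponent for [s]. *)
  apply: (@dietzmann _ _ sJ (\prod_(a <- s) o a)%N).
    by rewrite prodn_gt0 // => a; case: (oP a).
  move=> a as_; rewrite (big_rem a as_) /= expgnA.
  by rewrite (proj2 (oP a)) // expg1n.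
case: nvc; exists a.
have Cfin : finite_index [set c | commute a c].
  by apply: finite_centralizer_index Afin _ => g; rewrite sA; apply: sJ.
have [x xP] := finite_index_unbounded actI unb Cfin.
(* The constant must be strictly positive, as each reduction step gains a [delta]. *)
have slim1 : slim_triangles S (delta + 1).
  move=> p q r A B C HA HB HC c Ac;
  have [b ? cb] := slim p q r A B C HA HB HC c Ac.
  by exists b => //; lra.
have d1 : 0 < delta + 1 by lra.
have [N NP] := centralizer_cosets_bounded actI acyl
  (infinite_order_powers an) xP geoS d1 slim1.
have [[T Tfin TP]|H] := finite_net_or_sequence [set c | commute a c]
    (fun t c => generated [set a] (t^-1 * c)%g).
  exact: finite_index_trans Cfin Tfin TP.
have [f [fC fK]] := H N.
by have [i [j [/fK ij /ij]]] := NP f fC.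
Qed.
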